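(* Let $C$ be a unitary operator on a Hilbert space $H$. Then the regular semigroup $\tilde S\Gamma_C$ of pairs of linked cones, equipped with the componentwise addition and scalar multiplication and the norm $\|(\gamma,\tau)\|=\max\{\|\gamma\|,\|\tau\|\}$, is a normed algebra isomorphic to the normed algebra $\mathcal S$ of all finite rank bounded operators on $H$.
   Context: $H$ is a Hilbert space over $\mathbf K=\mathbb R$ or $\mathbb C$ with dual $H'$. Composition of maps is written from left to right ($T_1T_2$ means first $T_1$, then $T_2$), also for the product in $\mathcal S$, which carries the operator norm. $R(T)$ is the range of $T$; $P_N$ is the orthogonal projection onto a finite-dimensional subspace $N$. For a linear map $A:N\to M$ of finite-dimensional subspaces and an operator $P$ with range $N$, $PAP_M$ is the operator $x\mapsto A(P(x))$ on $H$. An isomorphism of normed algebras is an algebra isomorphism preserving the norm. $\mathcal F(H)$ (resp. $\mathcal F(H')$) is the category of finite-dimensional subspaces of $H$ (resp. $H'$) with all linear maps as morphisms. The objects of $\mathcal F(H')$ are $N'=\{f_n:n\in N\}$, $N$ a finite-dimensional subspace of $H$, with $f_n(x)=\langle x,n\rangle$. A cone with vertex $d$ assigns to each object $c$ a morphism $\gamma(c):c\to d$, compatible with restriction along subspace inclusions; it is normal if some component is an isomorphism, and bounded if the norms of its components are uniformly bounded. For $T\in\mathcal S$, $\gamma^T$ is the bounded normal cone in $\mathcal F(H)$ with vertex $R(T)$ and $\gamma^T(M)=T|_M:M\to R(T)$; $\tau^T$ is the bounded normal cone in $\mathcal F(H')$ with vertex $R(T^* )'$ and $\tau^T(M'):M'\to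 R(T^* )'$, $f_m\mapsto f_{T^*(m)}$. On the sets of bounded normal cones $B\mathcal F(H)=\{\gamma^T:T\in\mathcal S\}$ and $B\mathcal F(H')=\{\tau^T:T\in\mathcal S\}$ one uses the operations $\gamma^{T_1}+\gamma^{T_2}=\gamma^{T_1+T_2}$, $k\gamma^T=\gamma^{kT}$, $\gamma^{T_1}\cdot\gamma^{T_2}=\gamma^{T_1T_2}$, $\|\gamma^T\|=\|T\|$, and $\tau^{T_1}+\tau^{T_2}=\tau^{T_1+T_2}$, $k\tau^T=\tau^{kT}$, $\tau^{T_1}\cdot\tau^{T_2}=\tau^{T_2T_1}$, $\|\tau^T\|=\|T\|$. For an invertible bounded operator $C$ on $H$ and a finite-dimensional subspace $N$, $Q_{C^{-1}(N)}$ is the idempotent operator with range $C^{-1}(N)$ and kernel $C^{-1}(N^\perp)$. For finite-dimensional subspaces $M,N$ of $H$ put $$\Gamma_C(M,N')=\{\gamma^{Q_{C^{-1}(N)}AP_M}:A:C^{-1}(N)\to M\text{ linear}\},\quad \Delta_C(M,N')=\{\tau^{P_NBP_{C(M)}}:B:N\to C(M)\text{ linear}\},$$ and $\chi_C(M,N'):\Gamma_C(M,N')\to\Delta_C(M,N')$, $\gamma^{Q_{C^{-1}(N)}AP_M}\mapsto\tau^{P_NC^{-1}ACP_{C(M)}}$ (where $P_NC^{-1}ACP_{C(M)}$ is $x\mapsto C(A(C^{-1}(P_N x)))$). A pair $(\gamma,\tau)$ of normal cones in $\mathcal F(H)$ and $\mathcal F(H')$ is linked if there are finite-dimensional subspaces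 $M,N$ of $H$ with $\gamma\in\Gamma_C(M,N')$ and $\tau=\chi_C(M,N')(\gamma)$. $\tilde S\Gamma_C$ is the set of all pairs of linked cones, with $(\gamma_1,\tau_1)(\gamma_2,\tau_2)=(\gamma_1\cdot\gamma_2,\tau_2\cdot\tau_1)$, $(\gamma_1,\tau_1)+(\gamma_2,\tau_2)=(\gamma_1+\gamma_2,\tau_1+\tau_2)$, $k(\gamma,\tau)=(k\gamma,k\tau)$. *)

(* Defs.v *)
From HB Require Import structures.
From mathcomp Require Import all_boot all_order all_algebra.
From mathcomp Require Import complex.
From mathcomp Require Import all_classical all_reals.
From mathcomp Require Import topology normedtype.

Set Implicit Arguments.
Unset Strict Implicit.
Unset Printing Implicit Defensive.

Import Order.TTheory GRing.Theory Num.Theory.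
Import numFieldNormedType.Exports.

Local Open Scope classical_set_scope.
Local Open Scope ring_scope.

Section FiniteDimensional.
Variable K : fieldType.
Implicit Types V W : lmodType K.

Definition lspan V n (e : 'I_n -> V) : set V :=
  [set x | exists a : 'I_n -> K, x = \sum_i a i *: e i].

Definition finite_dim V (A : set V) := exists n (e : 'I_n -> V), A = lspan e.

Record fdspace V := FdSpace { fdset :> set V; fdsetP : finite_dim fdset }.

Definition fdpred V (N : fdspace V) : {pred V} := mem (fdset N).

Lemma span_closed V n (e : 'I_n -> V) : submod_closed (mem (lspan e)).
Proof.
split; first by rewrite inE; exists (fun=> 0); rewrite big1 // => i _; rewrite scale0r.
move=> a x y; rewrite !inE => -[b ->] [c ->].
exists (fun i => a * b i + c i); rewrite scaler_sumr -big_split /=.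
by apply: eq_bigr => i _; rewrite scalerDl scalerA.
Qed.

Lemma fdpred_closed V (N : fdspace V) : submod_closed (fdpred N).
Proof. by rewrite /fdpred; have [n [e ->]] := fdsetP N; exact: span_closed. Qed.

HB.instance Definition _ V (N : fdspace V) :=
  GRing.isSubmodClosed.Build K V (fdpred N) (fdpred_closed N).

Record fdelt V (N : fdspace V) :=
  FdElt { fdval :> V; fdvalP : fdval \in fdpred N }.

HB.instance Definition _ V (N : fdspace V) := [isSub for @fdval V N].
HB.instance Definition _ V (N : fdspace V) := [Choice of fdelt N by <:].
HB.instance Definition _ V (N : fdspace V) :=
  [SubChoice_isSubLmodule of fdelt N by <:].

Lemma finite_dim_sub V (A : set V) n (e : 'I_n -> V) :
  submod_closed (mem A) -> A `<=` lspan e -> finite_dim A.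
Proof.
elim: n e A => [|n IHn] e A cA sAe.
  by exists 0%N, e; apply/seteqP; split=> // x [a ->]; rewrite big_ord0 -in_setE; case: cA.
pose e' i := e (lift ord0 i).
have [sAe'|] := pselect (A `<=` lspan e'); first exact: (IHn e').
move=> /existsNP [w /not_implyP [Aw nw]].
have [m [f fE]] : finite_dim (A `&` lspan e').
  apply: (IHn e') => [|x []//]; have [s0 sL] := span_closed e'; have [a0 aL] := cA.
  split; first by rewrite inE; split; rewrite -in_setE.
  move=> a x y; rewrite !inE => -[Ax sx] [Ay sy].
  by split; rewrite -in_setE ?aL ?sL // inE.
have [a wE] := sAe _ Aw; rewrite big_ord_recl in wE.
have a0 : a ord0 != 0.
  by apply/eqP => a0; apply: nw; rewrite wE a0 scale0r add0r; exists (fun i => a (lift ord0 i)).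
exists m.+1, (fun i => if unlift ord0 i is Some j then f j else w).
have sE b : \sum_i b i *: (if unlift ord0 i is Some j then f j else w)
    = b ord0 *: w + \sum_i b (lift ord0 i) *: f i.
  rewrite big_ord_recl unlift_none; congr (_ + _).
  by apply: eq_bigr => i _; rewrite liftK.
have fA b : A (\sum_i b i *: f i).
  have : (A `&` lspan e') (\sum_i b i *: f i) by rewrite fE; exists b.
  by case.
have [A0 AL] := cA.
apply/seteqP; split=> x.
  move=> Ax; have [b xE] := sAe _ Ax; rewrite big_ord_recl in xE.
  have: (A `&` lspan e') (x - (b ord0 / a ord0) *: w).
    split; first by rewrite addrC -scaleNr -in_setE AL ?inE.
    exists (fun i => b (lift ord0 i) - b ord0 / a ord0 * a (lift ord0 i)).
    rewrite xE wE scalerDr scalerA divfK // opprD addrACA subrr add0r.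
    rewrite scaler_sumr -sumrB; apply: eq_bigr => i _.
    by rewrite scalerBl scalerA.
  rewrite fE => -[c xwE].
  exists (fun i => if unlift ord0 i is Some j then c j else b ord0 / a ord0).
  rewrite sE unlift_none.
  under eq_bigr do rewrite liftK.
  by rewrite -xwE addrC subrK.
by move=> [b ->]; rewrite sE -in_setE AL // inE.
Qed.

Lemma finite_dim_imgP V W (f : V -> W) (N : fdspace V) (s : K -> K) :
  (forall a, s (s a) = a) -> f 0 = 0 -> {morph f : x y / x + y} ->
  (forall a x, f (a *: x) = s a *: f x) -> finite_dim (f @` N).
Proof.
move=> sK f0 fD fZ; have [n [e Ne]] := fdsetP N; exists n, (f \o e).
have fE a : f (\sum_(i < n) a i *: e i) = \sum_i s (a i) *: f (e i).
  by rewrite (big_morph f fD f0); apply: eq_bigr => i _; rewrite fZ.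
rewrite Ne; apply/seteqP; split=> y /=.
  by move=> [x [a ->] <-]; exists (s \o a); rewrite fE.
move=> [a ->]; exists (\sum_i s (a i) *: e i); first by exists (s \o a).
by rewrite fE; apply: eq_bigr => i _; rewrite sK.
Qed.

Lemma finite_dim_img V W (f : {linear V -> W}) (N : fdspace V) :
  finite_dim (f @` N).
Proof.
apply: (@finite_dim_imgP _ _ _ _ id) => //; first exact: linear0.
  exact: linearD.
by move=> a x; rewrite linearZ.
Qed.

Definition fdimg V W (f : {linear V -> W}) (N : fdspace V) : fdspace W :=
  FdSpace (finite_dim_img f N).

(* A category whose objects are finite-dimensional subspaces of an ambient
   space, and whose morphisms are all the linear maps between them. *)
Structure subspace_cat := SubspaceCat {
  ambient : lmodType K;
  obj :> Type;
  carrier : obj -> fdspace ambient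
}.

Definition hom (X : subspace_cat) (c d : X) :=
  {linear fdelt (carrier c) -> fdelt (carrier d)}.

Record cone (X : subspace_cat) := Cone {
  vertex : X;
  component : forall c : X, hom c vertex;
  component_restrict : forall c1 c2 : X, carrier c1 `<=` carrier c2 ->
    forall (x : fdelt (carrier c1)) (y : fdelt (carrier c2)),
      fdval x = fdval y -> component c1 x = component c2 y
}.

Definition is_iso (X : subspace_cat) (c d : X) (f : hom c d) :=
  exists g : hom d c, cancel f g /\ cancel g f.

Definition normal_cone (X : subspace_cat) (g : cone X) :=
  exists c : X, is_iso (component g c).

End FiniteDimensional.

Variant scalar_kind := RealScalars | ComplexScalars.

Definition scalars (R : realType) (s : scalar_kind) : numFieldType :=
  match s with RealScalars => R | ComplexScalars => R[i]%C end.

Definition sconj (R : realType) (s : scalar_kind) :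
    {rmorphism scalars R s -> scalars R s} :=
  match s with RealScalars => idfun | ComplexScalars => @Num.conj R[i]%C end.

(* The norms of the library take their values in the scalar field; [re] turns
   them into elements of [R]. *)
Definition re (R : realType) (s : scalar_kind) : scalars R s -> R :=
  match s with RealScalars => id | ComplexScalars => @complex.Re R end.

Structure hilbert (R : realType) (s : scalar_kind) := Hilbert {
  hilbert_space :> completeNormedModType (scalars R s);
  inner : {dot hilbert_space for sconj R s};
  innerE : forall x : hilbert_space, inner x x = `|x| ^+ 2
}.

Section Operators.
Variables (R : realType) (s : scalar_kind) (H : hilbert R s).
Local Notation K := (scalars R s).
Local Notation "'[ x , y ]" := (inner H x y).

Definition ortho (N : set H) : set H := [set x | forall y, N y -> '[x, y] = 0].

Definition bounded_op (f : H -> H) :=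
  exists c : K, forall x, `|f x| <= c * `|x|.

Record finrank := FinRank {
  frfun :> H -> H;
  fr_linear : linear frfun;
  fr_bounded : bounded_op frfun;
  fr_finite : finite_dim (range frfun)
}.

HB.instance Definition _ := gen_eqMixin finrank.
HB.instance Definition _ := gen_choiceMixin finrank.
HB.instance Definition _ (T : finrank) :=
  GRing.isLinear.Build K H H _ (frfun T) (fr_linear T).

Lemma finrank_eq (T1 T2 : finrank) : T1 =1 T2 -> T1 = T2.
Proof.
case: T1 T2 => [f1 l1 b1 d1] [f2 l2 b2 d2] /= /funext f12; case: _ / f12 in l2 b2 d2 *.
by congr FinRank; exact: Prop_irrelevance.
Qed.

Definition range_fd (T : finrank) : fdspace H := FdSpace (fr_finite T).

Lemma range_fdP (T : finrank) x : T x \in fdpred (range_fd T).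
Proof. by rewrite inE; exists x. Qed.

Lemma bounded_ge0 f : bounded_op f -> exists2 c : K, 0 <= c & forall x, `|f x| <= c * `|x|.
Proof.
move=> [c cf]; have [[x x0]|nx] := pselect (exists x : H, x != 0).
  exists c => //; have := le_trans (normr_ge0 _) (cf x).
  by rewrite pmulr_lge0 // normr_gt0.
exists 0 => // x; have [->|x0] := eqVneq x 0; last by case: nx; exists x.
by have := cf 0; rewrite normr0 !mulr0.
Qed.

Lemma range_closed (f : H -> H) : linear f -> submod_closed (mem (range f)).
Proof.
move=> lf; pose g := HB.pack f (GRing.isLinear.Build _ _ _ _ f lf) : {linear H -> H}.
split=> [|a x y]; first by rewrite inE; exists 0 => //; exact: (linear0 g).
rewrite !inE => -[u _ <-] [v _ <-]; exists (a *: u + v) => //; exact: lf.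
Qed.

Lemma bounded_add f g : bounded_op f -> bounded_op g -> bounded_op (fun x => f x + g x).
Proof.
move=> [c cf] [d dg]; exists (c + d) => x.
by rewrite mulrDl (le_trans (ler_normD _ _)) // lerD.
Qed.

Lemma bounded_scale k f : bounded_op f -> bounded_op (fun x => k *: f x).
Proof. by move=> [c cf]; exists (`|k| * c) => x; rewrite normrZ -mulrA ler_wpM2l. Qed.

Lemma bounded_comp f g : bounded_op f -> bounded_op g -> bounded_op (f \o g).
Proof.
move=> /bounded_ge0 [c c0 cf] [d dg]; exists (c * d) => x /=.
by rewrite (le_trans (cf _)) // -mulrA ler_wpM2l.
Qed.

Lemma finite_dim_add (f g : H -> H) : linear f -> linear g ->
  finite_dim (range f) -> finite_dim (range g) ->
  finite_dim (range (fun x => f x + g x)).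
Proof.
move=> lf lg [n [e fe]] [m [e' ge]].
pose E i := match fintype.split i with inl i => e i | inr j => e' j end.
apply: (@finite_dim_sub _ _ _ _ E).
  by apply: range_closed => a x y; rewrite lf lg scalerDr addrACA.
move=> _ [x _ <-].
have [a ->] : lspan e (f x) by rewrite -fe; exists x.
have [b ->] : lspan e' (g x) by rewrite -ge; exists x.
exists (fun i => match fintype.split i with inl i => a i | inr j => b j end).
rewrite big_split_ord /=; congr (_ + _); apply: eq_bigr => i _; rewrite /E.
  by rewrite (unsplitK (inl i)).
by rewrite (unsplitK (inr i)).
Qed.

Lemma finite_dim_scale k (f : H -> H) : linear f ->
  finite_dim (range f) -> finite_dim (range (fun x => k *: f x)).
Proof.
move=> lf [n [e fe]]; apply: (@finite_dim_sub _ _ _ _ e).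
  apply: range_closed => a x y; rewrite lf scalerDr !scalerA; congr (_ *: _ + _).
  exact: mulrC.
move=> _ [x _ <-].
have [a ->] : lspan e (f x) by rewrite -fe; exists x.
exists (fun i => k * a i); rewrite scaler_sumr.
by apply: eq_bigr => i _; rewrite scalerA.
Qed.

Lemma finite_dim_comp (f g : finrank) : finite_dim (range (f \o g)).
Proof.
have [n [e fe]] := fr_finite f; apply: (@finite_dim_sub _ _ _ _ e).
  by apply: range_closed => a x y /=; rewrite !linearP.
by move=> _ [x _ <-]; rewrite -fe; exists (g x).
Qed.

Lemma finite_dim0 : finite_dim (range (fun _ : H => 0 : H)).
Proof.
apply: (@finite_dim_sub _ _ _ 0%N (fun=> 0)).
  by apply: range_closed => a x y; rewrite scaler0 addr0.
by move=> _ [x _ <-]; exists (fun=> 0); rewrite big_ord0.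
Qed.

Definition fr0 : finrank.
Proof.
apply: (@FinRank (fun=> 0)); last exact: finite_dim0.
- by move=> a x y; rewrite scaler0 addr0.
- by exists 0 => x; rewrite normr0 mul0r.
Defined.

Definition fr_add (T1 T2 : finrank) : finrank.
Proof.
apply: (@FinRank (fun x => T1 x + T2 x)).
- by move=> a x y; rewrite !linearP scalerDr addrACA.
- exact: bounded_add (fr_bounded T1) (fr_bounded T2).
- exact: finite_dim_add (fr_linear T1) (fr_linear T2) (fr_finite T1) (fr_finite T2).
Defined.

Definition fr_scale (k : K) (T : finrank) : finrank.
Proof.
apply: (@FinRank (fun x => k *: T x)).
- by move=> a x y; rewrite linearP scalerDr !scalerA mulrC.
- exact: bounded_scale (fr_bounded T).
- exact: finite_dim_scale (fr_linear T) (fr_finite T).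
Defined.

(* Products are written from left to right: first [T1], then [T2]. *)
Definition fr_mul (T1 T2 : finrank) : finrank.
Proof.
apply: (@FinRank (T2 \o T1)).
- by move=> a x y /=; rewrite !linearP.
- exact: bounded_comp (fr_bounded T2) (fr_bounded T1).
- exact: finite_dim_comp.
Defined.

Definition fr_norm (T : finrank) : R :=
  sup [set re `|T x| | x in [set x : H | `|x| <= 1]].

(* The default value is never used: every [T] has an adjoint, which again is
   bounded and of finite rank. *)
Definition adjoint (T : finrank) : finrank :=
  xget fr0 [set T' : finrank | forall x y, '[T x, y] = '[x, T' y]].

Definition FH : subspace_cat K := @SubspaceCat K H (fdspace H) id.

Section Gamma.
Variable T : finrank.

Definition gamma_fun (M : FH) (x : fdelt (carrier M)) :
    fdelt (carrier (range_fd T : FH)) :=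
  FdElt (range_fdP T (fdval x)).

Lemma gamma_linear M : linear (@gamma_fun M).
Proof. by move=> a x y; apply: val_inj; rewrite /= linearP. Qed.

HB.instance Definition _ M :=
  GRing.isLinear.Build K (fdelt (carrier M)) _ _ (@gamma_fun M) (@gamma_linear M).

Lemma gamma_restrict (c1 c2 : FH) : carrier c1 `<=` carrier c2 ->
  forall (x : fdelt (carrier c1)) (y : fdelt (carrier c2)),
    fdval x = fdval y -> gamma_fun x = gamma_fun y.
Proof. by move=> _ x y xy; apply: val_inj; rewrite /= xy. Qed.

Definition gamma : cone FH :=
  @Cone K FH (range_fd T) (fun M => @gamma_fun M) gamma_restrict.

End Gamma.

Definition functional (n : H) : H -> K^o := fun x => '[x, n].

Lemma conjK (a : K) : sconj R s (sconj R s a) = a.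
Proof. by move: a; rewrite /sconj; case: s => //= a; exact: conjCK. Qed.

Lemma functionalP a x y :
  functional (a *: x + y) = sconj R s a *: functional x + functional y.
Proof. by apply/funext => z; rewrite /functional linearPr. Qed.

Lemma functional0 : functional 0 = 0.
Proof. by apply/funext => z; rewrite /functional linear0r. Qed.

Lemma functional_inj : injective functional.
Proof.
move=> x y xy; apply/eqP; rewrite -subr_eq0 -normr_eq0 -sqrf_eq0 -innerE linearBr subr_eq0.
by apply/eqP; exact: (congr1 (fun f => f (x - y)) xy).
Qed.

Lemma functional_fd (N : fdspace H) : finite_dim (functional @` N).
Proof.
apply: (@finite_dim_imgP _ _ _ _ _ (sconj R s)) => [||x y|a x].
- exact: conjK.
- exact: functional0.
- by have := functionalP 1 x y; rewrite rmorph1 !scale1r.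
- by have := functionalP a x 0; rewrite functional0 !addr0.
Qed.

Definition dual_fd (N : fdspace H) : fdspace (H -> K^o) := FdSpace (functional_fd N).

(* Only subspaces of the form [N'] are objects; by the Riesz representation
   theorem these are all the finite-dimensional subspaces of the dual. *)
Definition FH' : subspace_cat K :=
  @SubspaceCat K (H -> K^o)
    {D : fdspace (H -> K^o) | exists N : fdspace H, D = dual_fd N} (@proj1_sig _ _).

Definition dual_obj (N : fdspace H) : FH' := exist _ (dual_fd N) (ex_intro _ N erefl).

(* The vector [m] such that [f] is the functional [f_m]. *)
Definition representer (f : H -> K^o) : H := xget 0 [set m | f = functional m].

Lemma representerK (M : FH') (f : fdelt (carrier M)) :
  functional (representer (fdval f)) = fdval f.
Proof.
have [m fm] : exists m, fdval f = functional m.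
  have : fdset (proj1_sig M) (fdval f) by rewrite -in_setE; exact: (fdvalP f).
  by have [N ->] := proj2_sig M => -[m _ <-]; exists m.
by apply: esym; apply: (@xgetPex _ 0 [set m | fdval f = functional m]); exists m.
Qed.

Section Tau.
Variable T : finrank.

Definition tau_vertex : FH' := dual_obj (range_fd (adjoint T)).

Lemma tau_funP x : functional (adjoint T x) \in fdpred (carrier tau_vertex).
Proof. by rewrite inE; exists (adjoint T x) => //; exists x. Qed.

Definition tau_fun (M : FH') (f : fdelt (carrier M)) : fdelt (carrier tau_vertex) :=
  FdElt (tau_funP (representer (fdval f))).

Lemma tau_linear M : linear (@tau_fun M).
Proof.
move=> a f g; apply: val_inj => /=.
rewrite -[a in RHS]conjK -functionalP -linearP; congr (functional (adjoint T _)).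
by apply: functional_inj; rewrite functionalP !representerK conjK; exact: (representerK (a *: f + g)).
Qed.

HB.instance Definition _ M :=
  GRing.isLinear.Build K (fdelt (carrier M)) _ _ (@tau_fun M) (@tau_linear M).

Lemma tau_restrict (c1 c2 : FH') : carrier c1 `<=` carrier c2 ->
  forall (f : fdelt (carrier c1)) (g : fdelt (carrier c2)),
    fdval f = fdval g -> tau_fun f = tau_fun g.
Proof. by move=> _ f g fg; apply: val_inj; rewrite /= fg. Qed.

Definition tau : cone FH' :=
  @Cone K FH' tau_vertex (fun M => @tau_fun M) tau_restrict.

End Tau.


(* The operator [x |-> P x] is kept with [N] as its codomain, so that maps
   defined on [N] can be applied after it. *)
Definition is_projection (N : fdspace H) (B : set H) (P : {linear H -> fdelt N}) :=
  [/\ forall x, P (fdval (P x)) = P x,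
      range (fun x => fdval (P x)) = N
    & [set x | P x = 0] = B].
Arguments is_projection : clear implicits.

Lemma inner_sym x y : '[x, y] = 0 -> '[y, x] = 0.
Proof. by move=> xy; rewrite hermC; move: xy => /= ->; rewrite rmorph0 mulr0. Qed.

Lemma innerDl x y z : '[x + y, z] = '[x, z] + '[y, z]. Proof. exact: linearDl. Qed.
Lemma innerDr x y z : '[z, x + y] = '[z, x] + '[z, y]. Proof. exact: linearDr. Qed.
Lemma innerBl x y z : '[x - y, z] = '[x, z] - '[y, z]. Proof. exact: linearBl. Qed.
Lemma innerZl a x y : '[a *: x, y] = a * '[x, y]. Proof. exact: linearZl_LR. Qed.
Lemma innerZr a x y : '[x, a *: y] = sconj R s a * '[x, y]. Proof. exact: linearZr_LR. Qed.
Lemma inner0l y : '[0, y] = 0. Proof. exact: linear0l. Qed.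

Lemma inner_suml n (f : 'I_n -> H) (P : pred 'I_n) y :
  '[\sum_(i | P i) f i, y] = \sum_(i | P i) '[f i, y].
Proof. exact: linear_sumlz. Qed.

Lemma inner_sumr n (f : 'I_n -> H) (P : pred 'I_n) y :
  '[y, \sum_(i | P i) f i] = \sum_(i | P i) '[y, f i].
Proof. exact: linear_sumr. Qed.

Lemma orthogonal_basis n (e : 'I_n -> H) : exists m (f : 'I_m -> H),
  [/\ lspan f = lspan e, forall i, f i != 0 & forall i j, i != j -> '[f i, f j] = 0].
Proof.
elim: n e => [|n IHn] e; first by exists 0%N, e; split=> // -[].
have [m [f [fe f0 fo]]] := IHn (fun i => e (lift ord0 i)).
pose p := \sum_i ('[e ord0, f i] / '[f i, f i]) *: f i.
pose w := e ord0 - p.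
have sp : lspan f p by exists (fun i => '[e ord0, f i] / '[f i, f i]).
have ff0 i : '[f i, f i] != 0 by rewrite innerE sqrf_eq0 normr_eq0.
have wf j : '[w, f j] = 0.
  rewrite /w innerBl inner_suml (bigD1 j) //= big1 => [|i ij].
    by rewrite addr0 innerZl divfK // subrr.
  by rewrite innerZl (fo _ _ ij) mulr0.
have se : lspan e = [set x | exists a y, lspan f y /\ x = a *: w + y].
  have [_ fL] := span_closed f.
  apply/seteqP; split=> x /=.
    move=> [a ->]; rewrite big_ord_recl.
    exists (a ord0), (a ord0 *: p + \sum_(i < n) a (lift ord0 i) *: e (lift ord0 i)).
    split; last by rewrite /w scalerBr addrA subrK.
    by rewrite -in_setE fL // inE // fe; exists (fun i => a (lift ord0 i)).
  move=> [a [y [sy ->]]].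
  have : lspan f (- a *: p + y) by rewrite -in_setE fL // inE.
  rewrite fe => -[b bE].
  exists (fun i => if unlift ord0 i is Some j then b j else a).
  rewrite big_ord_recl unlift_none.
  under eq_bigr do rewrite liftK.
  by rewrite -bE /w scalerBr scaleNr addrA.
have [w0|w0] := eqVneq w 0.
  exists m, f; split=> //; rewrite se; apply/seteqP; split=> x /=.
    by move=> sx; exists 0, x; rewrite scale0r add0r.
  by move=> [a [y [sy ->]]]; rewrite w0 scaler0 add0r.
exists m.+1, (fun i => if unlift ord0 i is Some j then f j else w); split.
- rewrite se; apply/seteqP; split=> x /=.
    move=> [a ->]; rewrite big_ord_recl unlift_none.
    exists (a ord0), (\sum_i a (lift ord0 i) *: f i); split.
      by exists (fun i => a (lift ord0 i)).
    by congr (_ + _); apply: eq_bigr => i _; rewrite liftK.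
  move=> [a [y [[b ->] ->]]].
  exists (fun i => if unlift ord0 i is Some j then b j else a).
  rewrite big_ord_recl unlift_none; congr (_ + _).
  by apply: eq_bigr => i _; rewrite liftK.
- by move=> i; case: unliftP.
- move=> i j; case: unliftP => [i'|] ->; case: unliftP => [j'|] -> //.
  + by rewrite (inj_eq lift_inj); exact: fo.
  + by move=> _; apply: inner_sym.
Qed.

Lemma fd_basis (N : fdspace H) : exists m (f : 'I_m -> H),
  [/\ N = lspan f :> set H, forall i, f i != 0 & forall i j, i != j -> '[f i, f j] = 0].
Proof.
have [n [e Ne]] := fdsetP N; have [m [f [fe f0 fo]]] := orthogonal_basis e.
by exists m, f; split=> //; rewrite Ne fe.
Qed.

Lemma orthogonal_coef m (f : 'I_m -> H) (a : 'I_m -> K) j :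
  (forall i, f i != 0) -> (forall i j, i != j -> '[f i, f j] = 0) ->
  '[\sum_i a i *: f i, f j] / '[f j, f j] = a j.
Proof.
move=> f0 fo; rewrite inner_suml (bigD1 j) //= big1 => [|i ij].
  by rewrite addr0 innerZl mulfK // innerE sqrf_eq0 normr_eq0.
by rewrite innerZl (fo _ _ ij) mulr0.
Qed.

Lemma projection_ex (N : fdspace H) : exists P, is_projection N (ortho N) P.
Proof.
have [m [f [Nf f0 fo]]] := fd_basis N.
pose p (x : H) := \sum_i ('[x, f i] / '[f i, f i]) *: f i.
have pN x : p x \in fdpred N by rewrite inE Nf; exists (fun i => '[x, f i] / '[f i, f i]).
pose P x := FdElt (pN x).
have Pl : linear P.
  move=> a x y; apply: val_inj => /=; rewrite /p scaler_sumr -big_split /=.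
  by apply: eq_bigr => i _; rewrite innerDl innerZl mulrDl scalerDl scalerA mulrA.
have pK x : fdset N x -> p x = x.
  by rewrite Nf => -[a ->]; apply: eq_bigr => i _; rewrite orthogonal_coef.
have Nval (y : fdelt N) : fdset N (fdval y) by rewrite -in_setE; exact: fdvalP.
pose Q := HB.pack P (GRing.isLinear.Build _ _ _ _ P Pl) : {linear H -> fdelt N}.
have nf i : fdset N (f i).
  rewrite Nf; exists (fun j => (i == j)%:R); rewrite (bigD1 i) //= eqxx scale1r.
  by rewrite big1 ?addr0 // => j /negPf ji; rewrite eq_sym ji scale0r.
exists Q; split=> [x||].
- by apply: val_inj => /=; exact/pK/(Nval (P x)).
- apply/seteqP; split=> x /=; first by move=> [y _ <-]; exact: (Nval (P y)).
  by move=> Nx; exists x => //; exact: pK.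
apply/seteqP; split=> x /=.
  move=> /(congr1 (@fdval _ _ _)) /= px y; rewrite Nf => -[a ->].
  rewrite inner_sumr big1 // => i _; rewrite innerZr.
  have := orthogonal_coef (fun i => '[x, f i] / '[f i, f i]) i f0 fo.
  rewrite -/(p x) px inner0l mul0r => /esym/eqP.
  rewrite mulf_eq0 invr_eq0 innerE sqrf_eq0 normr_eq0 (negPf (f0 i)) orbF.
  by move=> /eqP ->; rewrite mulr0.
move=> ox; apply: val_inj => /=.
by rewrite /p big1 // => i _; rewrite (ox _ (nf i)) mul0r scale0r.
Qed.

Definition oproj (N : fdspace H) : {linear H -> fdelt N} := sval (cid (projection_ex N)).

Lemma oprojP N : is_projection N (ortho N) (oproj N).
Proof. exact: svalP. Qed.

Lemma pythagoras (p q : H) : '[p, q] = 0 -> `|p| <= `|p + q|.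
Proof.
move=> pq; rewrite -(@ler_pXn2r _ 2) ?nnegrE // -!innerE.
rewrite innerDl !innerDr pq (inner_sym pq) addr0 add0r lerDl innerE.
exact: exprn_ge0.
Qed.

Lemma bounded_fd (N : fdspace H) (L : {linear fdelt N -> H}) :
  exists2 c : K, 0 <= c & forall y, `|L y| <= c * `|fdval y|.
Proof.
have [m [f [Nf f0 fo]]] := fd_basis N.
have nf i : f i \in fdpred N.
  rewrite inE Nf; exists (fun j => (i == j)%:R); rewrite (bigD1 i) //= eqxx scale1r.
  by rewrite big1 ?addr0 // => j /negPf ji; rewrite eq_sym ji scale0r.
pose g i := FdElt (nf i).
exists (\sum_i `|L (g i)| / `|f i|); first by apply: sumr_ge0 => i _; rewrite divr_ge0.
move=> y; have : fdset N (fdval y) by rewrite -in_setE; exact: fdvalP.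
rewrite Nf => -[a ya].
have vg : fdval (\sum_i a i *: g i) = fdval y.
  by rewrite -[LHS]/(\val _) linear_sum ya; apply: eq_bigr => i _; rewrite linearZ.
rewrite -vg -(val_inj vg : _ = y) vg.
rewrite linear_sum mulr_suml (le_trans (ler_norm_sum _ _ _)) // ler_sum // => i _.
rewrite linearZ normrZ mulrAC -mulrA mulrC ler_wpM2l //.
rewrite ler_pdivlMr ?normr_gt0 // -normrZ ya (bigD1 i) //=.
apply: pythagoras; rewrite innerZl inner_sumr big1 ?mulr0 //= => j ji.
by rewrite innerZr fo ?mulr0 // eq_sym.
Qed.

(* Invertible bounded operators; [iop_inv C] is [C^-1]. *)
Record invertible_op := InvertibleOp {
  iop :> {linear H -> H};
  iop_inv : {linear H -> H};
  iop_bounded : bounded_op iop;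
  iop_inv_bounded : bounded_op iop_inv;
  iopK : cancel iop iop_inv;
  iop_invK : cancel iop_inv iop
}.

Definition unitary (C : invertible_op) :=
  forall x y, '[C x, y] = '[x, iop_inv C y].

Lemma iproj_ex (C : invertible_op) (N : fdspace H) :
  exists Q, is_projection (fdimg (iop_inv C) N) (iop_inv C @` ortho N) Q.
Proof.
have [PK Pr Pk] := oprojP N.
have qN x : iop_inv C (fdval (oproj N (C x))) \in fdpred (fdimg (iop_inv C) N).
  by rewrite inE; exists (fdval (oproj N (C x))) => //; rewrite -in_setE; exact: fdvalP.
pose Q x := FdElt (qN x).
have Ql : linear Q by move=> a x y; apply: val_inj; rewrite /= !linearP.
have PN x : fdset N x -> fdval (oproj N x) = x by rewrite -Pr => -[y _ <-]; rewrite PK.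
exists (HB.pack Q (GRing.isLinear.Build _ _ _ _ Q Ql) : {linear H -> fdelt (fdimg (iop_inv C) N)}).
split=> [x||].
- by apply: val_inj; rewrite /= iop_invK PK.
- apply/seteqP; split=> x /=.
    by move=> [y _ <-]; exists (fdval (oproj N (C y))) => //; rewrite -in_setE; exact: fdvalP.
  by move=> [y Ny <-]; exists (iop_inv C y) => //; rewrite iop_invK PN.
rewrite -Pk; apply/seteqP; split=> x /=.
  move=> /(congr1 (@fdval _ _ _)) /= /(congr1 C); rewrite iop_invK linear0 => Px.
  by exists (C x); [exact: val_inj | rewrite iopK].
by move=> [y Py <-]; apply: val_inj; rewrite /= iop_invK Py linear0.
Qed.

(* [Q_{C^-1(N)}] *)
Definition iproj (C : invertible_op) (N : fdspace H) :
    {linear H -> fdelt (fdimg (iop_inv C) N)} := sval (cid (iproj_ex C N)).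

Lemma iprojP C N :
  is_projection (fdimg (iop_inv C) N) (iop_inv C @` ortho N) (iproj C N).
Proof. exact: svalP. Qed.

Lemma fdeltP (N : fdspace H) (y : fdelt N) : fdset N (fdval y).
Proof. by rewrite -in_setE; exact: fdvalP. Qed.

Lemma projection_split (N : fdspace H) B P : is_projection N B P ->
  forall x, B (x - fdval (P x)).
Proof.
by move=> [PK _ <-] x /=; rewrite linearB PK subrr.
Qed.

Lemma oproj_bounded N : bounded_op (fun x => fdval (oproj N x)).
Proof.
exists 1 => x; rewrite mul1r -[in leRHS](subrKC (fdval (oproj N x)) x).
apply: pythagoras; apply: inner_sym.
by apply: (projection_split (oprojP N)); exact: fdeltP.
Qed.

Lemma iproj_bounded C N : bounded_op (fun x => fdval (iproj C N x)).
Proof.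
have [c c0 cP] := bounded_ge0 (iop_inv_bounded C).
have [d dP] := iop_bounded C.
exists (c * d) => x; set p := fdval _.
have [q Nq qp] : (iop_inv C @` N) p by exact: (fdeltP (iproj C N x)).
have [r Or rp] : (iop_inv C @` ortho N) (x - p) := projection_split (iprojP C N) x.
have Cx : C x = q + r.
  by rewrite -[x](subrKC p) -rp -qp linearD !iop_invK.
rewrite -qp (le_trans (cP _)) // -mulrA ler_wpM2l // (le_trans _ (dP _)) // Cx.
by apply: pythagoras; apply: inner_sym; apply: Or.
Qed.

Section After.
Variables (N M : fdspace H) (P : {linear H -> fdelt N}).
Hypothesis Pb : bounded_op (fun x => fdval (P x)).
Variable A : {linear fdelt N -> fdelt M}.

Let f (x : H) : H := fdval (A (P x)).

Let f_linear : linear f. Proof. by move=> a x y; rewrite /f !linearP. Qed.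

Lemma after_bounded : bounded_op f.
Proof.
pose L (y : fdelt N) : H := fdval (A y).
have Ll : linear L by move=> a x y; rewrite /L !linearP.
have [c c0 cP] := bounded_fd (HB.pack L (GRing.isLinear.Build _ _ _ _ L Ll) : {linear _ -> _}).
have [d dP] := Pb; exists (c * d) => x.
by rewrite (le_trans (cP (P x))) // -mulrA ler_wpM2l.
Qed.

Lemma after_finite : finite_dim (range f).
Proof.
have [n [e Me]] := fdsetP M; apply: (@finite_dim_sub _ _ _ _ e).
  exact: range_closed.
by move=> _ [x _ <-]; rewrite -Me; exact: fdeltP.
Qed.

Definition after : finrank := FinRank f_linear after_bounded after_finite.

End After.

(* [Q_{C^-1(N)} A P_M] *)
Definition QAP C (M N : fdspace H)
    (A : {linear fdelt (fdimg (iop_inv C) N) -> fdelt M}) : finrank :=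
  after (iproj_bounded C N) A.

(* [P_N B P_{C(M)}] *)
Definition PBP (C : invertible_op) (M N : fdspace H)
    (B : {linear fdelt N -> fdelt (fdimg C M)}) : finrank :=
  after (oproj_bounded N) B.

Definition Gamma C (M N : fdspace H) : set (cone FH) :=
  range (fun A : {linear fdelt (fdimg (iop_inv C) N) -> fdelt M} => gamma (QAP A)).

Definition Delta (C : invertible_op) (M N : fdspace H) : set (cone FH') :=
  range (fun B : {linear fdelt N -> fdelt (fdimg C M)} => tau (PBP B)).

Section Transport.
Variables (C : invertible_op) (M N : fdspace H).
Variable A : {linear fdelt (fdimg (iop_inv C) N) -> fdelt M}.

Lemma fdimgP (L : {linear H -> H}) (D : fdspace H) (y : fdelt D) :
  L (fdval y) \in fdpred (fdimg L D).
Proof. by rewrite inE; exists (fdval y) => //; exact: fdeltP. Qed.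

(* [C^-1 A C], from left to right, on [N] *)
Definition transport (y : fdelt N) : fdelt (fdimg C M) :=
  FdElt (fdimgP C (A (FdElt (fdimgP (iop_inv C) y)))).

Lemma transport_linear : linear transport.
Proof.
pose u (y : fdelt N) := FdElt (fdimgP (iop_inv C) y).
move=> a x y; have uP : u (a *: x + y) = a *: u x + u y.
  by apply: val_inj; rewrite /= linearP.
by apply: val_inj; change (C (fdval (A (u (a *: x + y)))) = a *: C (fdval (A (u x))) + C (fdval (A (u y)))); rewrite uP !linearP.
Qed.

HB.instance Definition _ := GRing.isLinear.Build _ _ _ _ transport transport_linear.

End Transport.

Lemma chiP C M N (A : {linear fdelt (fdimg (iop_inv C) N) -> fdelt M}) :
  Delta C M N (tau (PBP (transport A))).
Proof. by exists (transport A). Qed.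

(* [A] is determined by the cone [g], so that the choice is immaterial. *)
Definition chi C M N (g : {g | Gamma C M N g}) : {t | Delta C M N t} :=
  let A := sval (cid2 (svalP g)) in exist _ (tau (PBP (transport A))) (chiP A).

Definition linked C (g : cone FH) (t : cone FH') :=
  [/\ normal_cone g, normal_cone t
    & exists M N (h : Gamma C M N g), t = sval (chi (exist _ g h))].

Definition linked_pairs C : set (cone FH * cone FH') := [set p | linked C p.1 p.2].

(* The operator [T] such that the cone is [gamma T] (resp. [tau T]); it is
   unique. The operations below are meant for cones of these forms only. *)
Definition gamma_op (g : cone FH) : finrank := xget fr0 [set T | g = gamma T].
Definition tau_op (t : cone FH') : finrank := xget fr0 [set T | t = tau T].

Definition gadd g1 g2 := gamma (fr_add (gamma_op g1) (gamma_op g2)).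
Definition gscale k g := gamma (fr_scale k (gamma_op g)).
Definition gmul g1 g2 := gamma (fr_mul (gamma_op g1) (gamma_op g2)).
Definition gnorm g := fr_norm (gamma_op g).

Definition tadd t1 t2 := tau (fr_add (tau_op t1) (tau_op t2)).
Definition tscale k t := tau (fr_scale k (tau_op t)).
(* The order is reversed: [tau T1] times [tau T2] is [tau (T2 T1)]. *)
Definition tmul t1 t2 := tau (fr_mul (tau_op t2) (tau_op t1)).
Definition tnorm t := fr_norm (tau_op t).

End Operators.

Record alg_ops (R : realType) (s : scalar_kind) (X : Type) := AlgOps {
  op_add : X -> X -> X;
  op_scale : scalars R s -> X -> X;
  op_mul : X -> X -> X;
  op_norm : X -> R
}.

Definition finrank_ops R s (H : hilbert R s) : alg_ops R s (finrank H) :=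
  AlgOps (@fr_add _ _ H) (@fr_scale _ _ H) (@fr_mul _ _ H) (@fr_norm _ _ H).

Definition pair_ops R s (H : hilbert R s) : alg_ops R s (cone (FH H) * cone (FH' H)) :=
  AlgOps (fun p q => (gadd p.1 q.1, tadd p.2 q.2))
         (fun k p => (gscale k p.1, tscale k p.2))
         (fun p q => (gmul p.1 q.1, tmul q.2 p.2))
         (fun p => Num.max (gnorm p.1) (tnorm p.2)).

Section Algebras.
Variables (R : realType) (s : scalar_kind).
Local Notation K := (scalars R s).

Definition regular_semigroup X (D : set X) (mul : X -> X -> X) :=
  [/\ forall x y, D x -> D y -> D (mul x y),
      forall x y z, D x -> D y -> D z -> mul x (mul y z) = mul (mul x y) z
    & forall x, D x -> exists2 y, D y & mul (mul x y) x = x].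

(* Associative algebras over [K], not necessarily unital. *)
Record normed_algebra X (D : set X) (o : alg_ops R s X) : Prop := NormedAlgebra {
  na_add_closed : forall x y, D x -> D y -> D (op_add o x y);
  na_scale_closed : forall k x, D x -> D (op_scale o k x);
  na_mul_closed : forall x y, D x -> D y -> D (op_mul o x y);
  na_addA : forall x y z, D x -> D y -> D z ->
    op_add o x (op_add o y z) = op_add o (op_add o x y) z;
  na_addC : forall x y, D x -> D y -> op_add o x y = op_add o y x;
  na_zero : exists2 z, D z & forall x, D x ->
    [/\ op_add o z x = x, exists2 y, D y & op_add o y x = z
      & op_norm o x = 0 <-> x = z];
  na_scaleA : forall k l x, D x -> op_scale o k (op_scale o l x) = op_scale o (k * l) x;
  na_scale1 : forall x, D x -> op_scale o 1 x = x;
  na_scaleDr : forall k x y, D x -> D y ->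
    op_scale o k (op_add o x y) = op_add o (op_scale o k x) (op_scale o k y);
  na_scaleDl : forall k l x, D x ->
    op_scale o (k + l) x = op_add o (op_scale o k x) (op_scale o l x);
  na_mulA : forall x y z, D x -> D y -> D z ->
    op_mul o x (op_mul o y z) = op_mul o (op_mul o x y) z;
  na_mulDl : forall x y z, D x -> D y -> D z ->
    op_mul o (op_add o x y) z = op_add o (op_mul o x z) (op_mul o y z);
  na_mulDr : forall x y z, D x -> D y -> D z ->
    op_mul o x (op_add o y z) = op_add o (op_mul o x y) (op_mul o x z);
  na_scaleAl : forall k x y, D x -> D y ->
    op_scale o k (op_mul o x y) = op_mul o (op_scale o k x) y;
  na_scaleAr : forall k x y, D x -> D y ->
    op_scale o k (op_mul o x y) = op_mul o x (op_scale o k y);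
  na_norm_ge0 : forall x, D x -> 0 <= op_norm o x;
  na_normZ : forall k x, D x -> op_norm o (op_scale o k x) = re `|k| * op_norm o x;
  na_normD : forall x y, D x -> D y -> op_norm o (op_add o x y) <= op_norm o x + op_norm o y;
  na_normM : forall x y, D x -> D y -> op_norm o (op_mul o x y) <= op_norm o x * op_norm o y
}.

Definition normed_algebra_iso X Y (D : set X) (o : alg_ops R s X)
    (E : set Y) (o' : alg_ops R s Y) (f : X -> Y) :=
  set_bij D E f /\
  [/\ forall x y, D x -> D y -> f (op_add o x y) = op_add o' (f x) (f y),
      forall k x, D x -> f (op_scale o k x) = op_scale o' k (f x),
      forall x y, D x -> D y -> f (op_mul o x y) = op_mul o' (f x) (f y)
    & forall x, D x -> op_norm o' (f x) = op_norm o x].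

End Algebras.

(* Main.v *)
Require Import Defs.
From HB Require Import structures.
From mathcomp Require Import all_boot all_order all_algebra.
From mathcomp Require Import complex.
From mathcomp Require Import all_classical all_reals.
From mathcomp Require Import topology normedtype.
From mathcomp Require Import ring lra.

Set Implicit Arguments.
Unset Strict Implicit.
Unset Printing Implicit Defensive.

Import Order.TTheory GRing.Theory Num.Theory.
Import numFieldNormedType.Exports.

Local Open Scope classical_set_scope.
Local Open Scope ring_scope.

(** The isomorphism sends an operator [T] to the pair
    [(gamma^T, tau^(C T C^-1))], where [C T C^-1] is the operator
    [x |-> C (T (C^-1 x))].

    The two components of a linked pair determine each other by this
    conjugation: [Q_{C^-1(N)}] is [C^-1 P_N C] as a composite of functions, so
    if [T = Q_{C^-1(N)} A P_M], then the operator attached to [chi_C(M, N')]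
    is [T] conjugated by [C] ([PBP_transport]). Conversely every [T] occurs:
    take for [M] the range of [T] and for [C^-1(N)] the range of its adjoint; as
    [C] is unitary, [Q = Q_{C^-1(N)}] is then the orthogonal projection along
    [ker T], the orthogonal complement of that range, so that [T (Q x) = T x]
    ([QAP_all]). So the set of linked pairs is exactly the image of the map ([linked_pairs_range]).

    The map is injective because a cone [gamma^T] or [tau^T] determines [T];
    this is also what makes the operations on cones compute as expected. For
    [tau^T] one needs that the adjoint of [T] exists, by the Riesz representation
    theorem: completeness gives a vector of least norm in a closed hyperplane
    ([closed_hyperplane_minimum]), and this vector is orthogonal to the kernel
    of the functional ([riesz]). The cones are normal because [T] has a
    generalized inverse [S] of finite rank, with [T S T = T] and [S T S = S]
    ([generalized_inverse]): the component of [gamma^T] at the vertex of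
    [gamma^S] and that of [tau^T] at the vertex of [tau^S] are invertible, with
    inverses given by the cones of [S]. The same [S] shows that the semigroup is
    regular.

    Finally, conjugation by a unitary preserves the operator norm
    ([norm_conj]), so the maximum of the two norms of a pair is the norm of
    [T], and the normed algebra structure is carried over from the operators. *)

(** * Real parts of nonnegative scalars *)

Section RealPart.
Variables (R : realType) (s : scalar_kind).
Implicit Types a b : scalars R s.

Lemma re0 : re (0 : scalars R s) = 0. Proof. by case: s. Qed.

Lemma re1 : re (1 : scalars R s) = 1. Proof. by case: s. Qed.

Lemma reD a b : re (a + b) = re a + re b.
Proof. by case: s a b => [//|] /= [? ?] [? ?]. Qed.

Lemma le_re a b : a <= b -> re a <= re b.
Proof. by case: s a b => [//|] /= a b; rewrite lecE => /andP[]. Qed.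

Lemma ge0_le_re a b : 0 <= a -> 0 <= b -> (re a <= re b) = (a <= b).
Proof.
case: s a b => [//|] /= a b; rewrite !lecE /= => /andP[/eqP -> _] /andP[/eqP -> _].
by rewrite eqxx.
Qed.

Lemma ge0_lt_re a b : 0 <= a -> 0 <= b -> (re a < re b) = (a < b).
Proof.
case: s a b => [//|] /= a b; rewrite !lecE ltcE /= => /andP[/eqP -> _] /andP[/eqP -> _].
by rewrite eqxx.
Qed.

Lemma ge0_reM a b : 0 <= a -> re (a * b) = re a * re b.
Proof.
case: s a b => [//|] /= a b; rewrite lecE => /andP[/eqP/= a0 _].
by case: a b a0 => [u v] [u' v'] /= ->; rewrite mul0r subr0.
Qed.

Lemma re_gt0 a : 0 < a -> 0 < re a.
Proof. by case: s a => [//|] /= a; rewrite ltcE => /andP[]. Qed.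

(** Balls of [H] have scalar radii, so real bounds must be carried to [K]. *)
Lemma re_lift (r : R) : 0 <= r -> exists2 a : scalars R s, 0 <= a & re a = r.
Proof.
case: s => r0; first by exists r.
by exists (r%:C)%C => //=; rewrite lecE /= eqxx.
Qed.

End RealPart.

(** * Norm and inner product *)

Section HilbertSpace.
Variables (R : realType) (s : scalar_kind) (H : hilbert R s).
Local Notation K := (scalars R s).
Local Notation "'[ x , y ]" := (inner H x y).
Implicit Types (x y z : H) (T : finrank H) (a : K).

(** The norm of [H] is a scalar; the infimum, the supremum and the nonlinear
    estimates below need it as an element of [R]. *)
Definition nrm x : R := re `|x|.

Lemma nrm_ge0 x : 0 <= nrm x.
Proof. by rewrite -(re0 R s); apply: le_re. Qed.

Lemma nrm0 : nrm 0 = 0. Proof. by rewrite /nrm normr0 re0. Qed.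

Lemma nrm_eq0 x : nrm x = 0 -> x = 0.
Proof.
move=> x0; apply/eqP; rewrite -normr_le0 -ge0_le_re // re0.
by rewrite -/(nrm x) x0.
Qed.

Lemma nrmD x y : nrm (x + y) <= nrm x + nrm y.
Proof. by rewrite /nrm -reD; apply: le_re; exact: ler_normD. Qed.

Lemma nrmZ a x : nrm (a *: x) = re `|a| * nrm x.
Proof. by rewrite /nrm normrZ ge0_reM. Qed.

Lemma nrm_sqr x : nrm x ^+ 2 = re '[x, x].
Proof. by rewrite innerE !expr2 ge0_reM. Qed.

Lemma nrm_double x : nrm (x + x) = 2 * nrm x.
Proof. by rewrite -mulr2n -scaler_nat nrmZ normr_nat mulr2n reD re1. Qed.

Lemma inner_eq0 x : '[x, x] = 0 -> x = 0.
Proof. by rewrite innerE => /eqP; rewrite sqrf_eq0 normr_eq0 => /eqP. Qed.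

Lemma inner_ext x y : (forall z, '[z, x] = '[z, y]) -> x = y.
Proof. by move=> xy; apply/functional_inj/funext. Qed.

Lemma parallelogram x y :
  nrm (x - y) ^+ 2 = 2 * nrm x ^+ 2 + 2 * nrm y ^+ 2 - nrm (x + y) ^+ 2.
Proof.
apply/eqP; rewrite eq_sym subr_eq eq_sym; apply/eqP.
rewrite !nrm_sqr !mulr_natl !mulr2n -!reD; congr re.
rewrite !innerDl !innerDr !linearNl !linearNr /= opprK.
ring.
Qed.

Lemma pythagorasE x y : '[x, y] = 0 -> nrm (x + y) ^+ 2 = nrm x ^+ 2 + nrm y ^+ 2.
Proof.
move=> xy; rewrite !nrm_sqr -reD innerDl !innerDr xy (inner_sym xy).
by rewrite addr0 add0r.
Qed.

Lemma inner_reject x y : '[x - ('[x, y] / '[y, y]) *: y, y] = 0.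
Proof.
rewrite innerBl innerZl; have [->|y0] := eqVneq y 0.
  by rewrite !linear0r mulr0 subrr.
rewrite divfK ?subrr //; apply: contra_neq y0; exact: inner_eq0.
Qed.

(** The component of [x] along [y] is shorter than [x], by Pythagoras. *)
Lemma cauchy_schwarz x y : `|'[x, y]| <= `|x| * `|y|.
Proof.
have [->|y0] := eqVneq y 0; first by rewrite linear0r !normr0 mulr0.
set a := '[x, y] / '[y, y].
have : '[a *: y, x - a *: y] = 0.
  by apply: inner_sym; rewrite innerZr inner_reject mulr0.
move=> /pythagoras; rewrite subrKC normrZ => ayx.
have -> : '[x, y] = a * '[y, y].
  by rewrite divfK //; apply: contra_neq y0; exact: inner_eq0.
by rewrite normrM innerE normrX normr_id expr2 mulrA ler_wpM2r.
Qed.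

(** * Riesz representation *)

(** By the parallelogram law two points of the hyperplane whose norms are close
    to the infimum [d] are close to each other, since the norm of their midpoint
    is at least [d]. Hence the sets of near-minimizers form a Cauchy filter; its
    limit stays in the hyperplane because [phi] is bounded. *)
Lemma closed_hyperplane_minimum (phi : {linear H -> K^o}) (c : K) (e : H) :
  (forall x, `|phi x| <= c * `|x|) -> phi e = 1 ->
  exists2 z, phi z = 1 & forall x, phi x = 1 -> nrm z <= nrm x.
Proof.
move=> phic phie.
pose S := [set x | phi x = 1].
pose d := inf (nrm @` S).
have dS x : S x -> d <= nrm x.
  move=> Sx; apply: ge_inf; last by exists x.
  by exists 0 => _ [y _ <-]; exact: nrm_ge0.
have d0 : 0 <= d.
  apply: lb_le_inf; first by exists (nrm e), e.
  by move=> _ [y _ <-]; exact: nrm_ge0.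
pose near_min (r : R) := [set x | S x /\ nrm x < d + r].
have near_min_ex r : 0 < r -> near_min r !=set0.
  move=> r0.
  have [|_ [x Sx <-] xr] := @inf_adherent _ (nrm @` S) _ r0; last by exists x.
  by split; [exists (nrm e), e | exists 0 => _ [y _ <-]; exact: nrm_ge0].
have midpoint x y : S x -> S y -> 2 * d <= nrm (x + y).
  move=> Sx Sy; have -> : x + y = 2^-1 *: (x + y) + 2^-1 *: (x + y).
    by rewrite -scalerDl -[2^-1]mul1r -splitr scale1r.
  rewrite nrm_double ler_pM2l // dS // /S /= linearZ linearD /= Sx Sy.
  by rewrite /GRing.scale /= mulVf // pnatr_eq0.
have near_min_close r x y : 0 < r -> near_min r x -> near_min r y ->
    nrm (x - y) ^+ 2 < 4 * (2 * d * r + r ^+ 2).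
  move=> r0 [Sx xr] [Sy yr]; rewrite parallelogram.
  have := midpoint _ _ Sx Sy; have := nrm_ge0 x; have := nrm_ge0 y.
  have := dS _ Sx; have := dS _ Sy.
  nra.
pose F := filter_from [set r : R | 0 < r] near_min.
have FF : ProperFilter F.
  apply: filter_from_proper => //; apply: filter_from_filter; first by exists 1 => /=.
  move=> i j /= i0 j0; exists (Num.min i j); first by rewrite /= lt_min i0.
  by move=> x [Sx]; rewrite -ltrBlDl lt_min !ltrBlDl => /andP[].
have Fc : cvg F.
  apply: cauchy_cvg; apply: cauchy_exP => eps eps0.
  have e0 := re_gt0 eps0.
  (* [r <= 1] gives [4 (2 d r + r ^ 2) <= m r], which is at most [re eps ^ 2]. *)
  pose m := 4 * (2 * d + 1).
  have m0 : 0 < m by rewrite mulr_gt0 // ltr_wpDl // mulr_ge0.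
  pose r := Num.min 1 (re eps ^+ 2 / m).
  have r0 : 0 < r by rewrite lt_min ltr01 /= divr_gt0 ?exprn_gt0.
  have [x xr] := near_min_ex _ r0; exists x.
  exists r => // y yr.
  rewrite -ball_normE /ball_ /= -ge0_lt_re ?(ltW eps0) // -/(nrm _).
  rewrite -(@ltr_pXn2r _ 2) ?nnegrE ?nrm_ge0 ?ltW //.
  have r1 : r <= 1 by rewrite ge_min lexx.
  have : r * m <= re eps ^+ 2 by rewrite -ler_pdivlMr // ge_min lexx orbT.
  rewrite /m; have := near_min_close _ _ _ r0 xr yr; nra.
move: Fc => /cvg_ex[z Fz].
have approx r : 0 < r -> exists x, [/\ phi x = 1, nrm x < d + r & nrm (z - x) < r].
  move=> r0; have [a a0 ar] := re_lift s (ltW r0).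
  have {}a0 : 0 < a by rewrite -ge0_lt_re ?lexx // re0 ar.
  have [i /= i0 iz] := Fz _ (nbhsx_ballx (z : H) a a0).
  have [|x [Sx xr]] := near_min_ex (Num.min r i); first by rewrite lt_min r0.
  exists x; split=> //.
    by rewrite (lt_le_trans xr) // lerD2l ge_min lexx.
  have /iz : near_min i x.
    by split=> //; rewrite (lt_le_trans xr) // lerD2l ge_min lexx orbT.
  by rewrite -ball_normE /ball_ /= -ge0_lt_re ?(ltW a0) // ar.
have c0 : 0 <= c.
  have e0 : 0 < `|e|.
    by rewrite normr_gt0; apply: contra_eq_neq phie => ->; rewrite linear0 eq_sym oner_eq0.
  by rewrite -(pmulr_lge0 _ e0) (le_trans _ (phic e)).
have rc0 : 0 <= re c by rewrite -(re0 R s) le_re.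
exists z.
  apply/eqP; rewrite -subr_eq0 -normr_le0 -ge0_le_re // re0 leNgt; apply/negP => p0.
  set p := re _ in p0.
  have [x [phix _ zx]] := approx (p / (re c + 1)) (divr_gt0 p0 (ltr_wpDl rc0 ltr01)).
  have : p <= re c * nrm (z - x).
    by rewrite /nrm -ge0_reM // le_re // (le_trans _ (phic _)) // linearB /= phix.
  rewrite leNgt => /negP; apply.
  move: zx; rewrite ltr_pdivlMr ?ltr_wpDl // => zx.
  have := nrm_ge0 (z - x); nra.
suff zd : nrm z <= d by move=> x Sx; exact: le_trans (dS _ Sx).
apply/ler_addgt0Pr => r r0; have [x [_ xr zx]] := approx (r / 2) (divr_gt0 r0 (ltr0n _ 2)).
have := nrmD (z - x) x; rewrite subrK; lra.
Qed.

(** The point [z] of least norm with [phi z = 1] is orthogonal to [ker phi]: for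
    [v] in [ker phi], removing from [z] its component along [v] stays in the
    hyperplane, and would shorten [z] if this component were nonzero. As
    [x - phi x *: z] is in [ker phi], [phi] is a multiple of the product with [z]. *)
Lemma riesz (phi : {linear H -> K^o}) : (exists c : K, forall x, `|phi x| <= c * `|x|) ->
  exists z, forall x, phi x = '[x, z].
Proof.
move=> [c phic].
have [[e phie]|phi0] := pselect (exists e, phi e = 1); last first.
  exists 0 => x; rewrite linear0r; apply/eqP/negP => /negP x0; apply: phi0.
  by exists ((phi x)^-1 *: x); rewrite linearZ /= /GRing.scale /= mulVf.
have [z phiz zmin] := closed_hyperplane_minimum phic phie.
have z0 : '[z, z] != 0.
  apply/eqP => /inner_eq0 z0; have := oner_eq0 K.
  by rewrite -phiz z0 linear0 eqxx.
have ker_orth v : phi v = 0 -> '[v, z] = 0.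
  move=> phiv; apply: inner_sym.
  pose t := '[z, v] / '[v, v]; pose w := z - t *: v.
  have wv : '[w, t *: v] = 0 by rewrite innerZr inner_reject mulr0.
  have := pythagorasE wv; rewrite subrK => zE.
  have phiw : phi w = 1 by rewrite linearB linearZ /= phiz phiv scaler0 subr0.
  have tv : t *: v = 0.
    apply: nrm_eq0; have := nrm_ge0 (t *: v); have := zmin _ phiw.
    have := nrm_ge0 z; have := nrm_ge0 w. nra.
  by rewrite -(inner_reject z v) -/t tv subr0.
exists (sconj R s '[z, z]^-1 *: z) => x.
have : '[x - phi x *: z, z] = 0.
  apply: ker_orth; rewrite linearB linearZ /= phiz.
  by rewrite /GRing.scale /= mulr1 subrr.
rewrite innerBl innerZl innerZr conjK => /eqP; rewrite subr_eq0 => /eqP ->.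
by rewrite mulrC mulfK.
Qed.

(** * Adjoints and generalized inverses *)

Lemma inner_conj x y : sconj R s '[x, y] = '[y, x].
Proof. by rewrite [RHS]hermC /= expr0 mul1r. Qed.

(** The source of all the operators constructed below, adjoints as well as
    generalized inverses: boundedness and finite rank come at once. *)
Lemma rank_sum_ex m (f z : 'I_m -> H) :
  exists S : finrank H, forall x, S x = \sum_i '[x, f i] *: z i.
Proof.
pose g x := \sum_i '[x, f i] *: z i.
have gl : linear g.
  move=> a x y; rewrite /g scaler_sumr -big_split /=; apply: eq_bigr => i _.
  by rewrite innerDl innerZl scalerDl scalerA.
have gb : bounded_op g.
  exists (\sum_i `|f i| * `|z i|) => x; rewrite mulr_suml.
  apply: le_trans (ler_norm_sum _ _ _) _; apply: ler_sum => i _.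
  rewrite normrZ mulrAC [`|f i| * _]mulrC ler_wpM2r //; exact: cauchy_schwarz.
have gf : finite_dim (range g).
  apply: (@finite_dim_sub _ _ _ _ z); first exact: range_closed.
  by move=> _ [x _ <-]; exists (fun i => '[x, f i]).
by exists (FinRank gl gb gf).
Qed.

(** In an orthogonal basis [f i] of the range of [T], the coordinates of [T x] are
    bounded functionals of [x], so by Riesz they are inner products with vectors
    [z i]; transposing the resulting sum of rank one operators gives the adjoint. *)
Lemma adjoint_ex T : exists T' : finrank H, forall x y, '[T x, y] = '[x, T' y].
Proof.
have [m [f [Tf f0 fo]]] := fd_basis (range_fd T).
have coord i : exists z, forall x, '[T x, f i] = '[x, z].
  pose phi x : K^o := '[T x, f i].
  have phil : linear phi by move=> a x y; rewrite /phi linearP innerDl innerZl.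
  apply: (riesz (phi := HB.pack phi (GRing.isLinear.Build _ _ _ _ phi phil))).
  have [c cT] := fr_bounded T; exists (c * `|f i|) => x /=.
  by rewrite (le_trans (cauchy_schwarz _ _)) // mulrAC ler_wpM2r.
have [z zE] := choice coord.
have [S SE] := rank_sum_ex f (fun i => sconj R s '[f i, f i]^-1 *: z i).
exists S => x y; rewrite SE inner_sumr.
have [a Tx] : lspan f (T x) by rewrite -Tf; exists x.
rewrite Tx inner_suml; apply: eq_bigr => i _.
rewrite !innerZr conjK -zE inner_conj innerZl mulrC; congr (_ * _).
by rewrite mulrC -(orthogonal_coef a i f0 fo) -Tx.
Qed.

Lemma adjointP T x y : '[T x, y] = '[x, adjoint T y].
Proof.
exact: (xgetPex (fr0 H) (P := [set T' | forall x y, '[T x, y] = '[x, T' y]]) (adjoint_ex T)).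
Qed.

Lemma adjoint_inj : injective (@adjoint R s H).
Proof.
move=> T1 T2 T12; apply: finrank_eq => x.
apply/eqP; rewrite -subr_eq0; apply/eqP/inner_eq0.
by rewrite innerBl !adjointP T12 subrr.
Qed.

(** On the range of [T] invert [T] by lifting an orthogonal basis, and precompose
    with the orthogonal projection onto the range: this gives [T S T = T]. The
    second equation holds after [S] is replaced by [S T S]. *)
Lemma generalized_inverse T : exists S : finrank H,
  (forall x, T (S (T x)) = T x) /\ (forall x, S (T (S x)) = S x).
Proof.
have [m [f [Tf f0 fo]]] := fd_basis (range_fd T).
have lift i : exists u, T u = f i.
  have : lspan f (f i).
    exists (fun j => (i == j)%:R); rewrite (bigD1 i) //= eqxx scale1r.
    by rewrite big1 ?addr0 // => j /negPf ji; rewrite eq_sym ji scale0r.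
  by rewrite -Tf => -[u _ <-]; exists u.
have [u uE] := choice lift.
have [S SE] := rank_sum_ex f (fun i => '[f i, f i]^-1 *: u i).
have TST x : T (S (T x)) = T x.
  rewrite SE linear_sum; have [a Tx] : lspan f (T x) by rewrite -Tf; exists x.
  rewrite [RHS]Tx; apply: eq_bigr => i _.
  by rewrite !linearZ /= scalerA uE Tx orthogonal_coef.
exists (fr_mul S (fr_mul T S)); split=> x /=; first by rewrite !TST.
by congr (S _); rewrite !TST.
Qed.

(** * Cones determine their operators *)

(** A vector lies in the line that it spans, so the component of the cone at this
    line recovers the value of the operator. *)
Lemma gamma_inj : injective (@gamma R s H).
Proof.
move=> T1 T2 T12; apply: finrank_eq => x.
have fx : finite_dim (lspan (fun _ : 'I_1 => x)) by exists 1%N, (fun=> x).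
have xx : x \in fdpred (FdSpace fx).
  by rewrite inE; exists (fun=> 1); rewrite big_ord1 scale1r.
exact: (congr1 (fun g => fdval (component g (FdSpace fx : FH H) (FdElt xx))) T12).
Qed.

Lemma tau_inj : injective (@tau R s H).
Proof.
move=> T1 T2 T12; apply: adjoint_inj; apply: finrank_eq => x.
have fx : finite_dim (lspan (fun _ : 'I_1 => x)) by exists 1%N, (fun=> x).
have xx : functional x \in fdpred (carrier (dual_obj (FdSpace fx))).
  rewrite inE; exists x => //.
  by exists (fun=> 1); rewrite big_ord1 scale1r.
have repr := functional_inj (representerK (FdElt xx)).
have := congr1 (fun g => fdval (component g (dual_obj (FdSpace fx)) (FdElt xx))) T12.
by move=> /functional_inj; rewrite /= repr.
Qed.

Lemma gamma_opK : cancel (@gamma R s H) (@gamma_op R s H).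
Proof.
move=> T; apply/esym/gamma_inj.
by apply: (xgetPex (fr0 H) (P := [set T' | gamma T = gamma T'])); exists T.
Qed.

Lemma tau_opK : cancel (@tau R s H) (@tau_op R s H).
Proof.
move=> T; apply/esym/tau_inj.
by apply: (xgetPex (fr0 H) (P := [set T' | tau T = tau T'])); exists T.
Qed.

(** * Normality *)

(** For a generalized inverse [S], the operators [T] and [S] restrict to mutually
    inverse maps between [R(S)] and [R(T)]. *)
Lemma gamma_normal T : normal_cone (gamma T).
Proof.
have [S [TST STS]] := generalized_inverse T.
exists (vertex (gamma S)); exists (component (gamma S) (vertex (gamma T))).
by split=> x; apply: val_inj => /=; case: (fdeltP x) => y _ <-.
Qed.

Lemma functionalK : cancel (@functional R s H) (@representer R s H).
Proof.
move=> x; apply: functional_inj; apply: esym.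
by apply: (xgetPex 0 (P := [set m | functional x = functional m])); exists x.
Qed.

Lemma fdelt_mem (F : fieldType) (V : lmodType F) (N : fdspace V) (y : fdelt N) :
  fdset N (fdval y).
Proof. by rewrite -in_setE; exact: fdvalP. Qed.

(** The adjoints of generalized inverses are generalized inverses, and [tau] lets
    them act on representing vectors. *)
Lemma tau_normal T : normal_cone (tau T).
Proof.
have [S [TST STS]] := generalized_inverse T.
have TSTa x : adjoint T (adjoint S (adjoint T x)) = adjoint T x.
  by apply: inner_ext => y; rewrite -!adjointP TST.
have STSa x : adjoint S (adjoint T (adjoint S x)) = adjoint S x.
  by apply: inner_ext => y; rewrite -!adjointP STS.
exists (vertex (tau S)); exists (component (tau S) (vertex (tau T))).
split=> x; apply: val_inj; have [_ [y _ <-] xE] := fdelt_mem x; rewrite /= functionalK.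
  by rewrite -xE functionalK STSa.
by rewrite -xE functionalK TSTa.
Qed.

(** * Linked pairs *)

Section Linked.
Variable C : invertible_op H.

Lemma conj_finite T : finite_dim (range (C \o T \o iop_inv C)).
Proof.
have [n [e Te]] := fr_finite T; apply: (@finite_dim_sub _ _ _ _ (C \o e)).
  by apply: range_closed => a x y /=; rewrite !linearP.
move=> _ [x _ <-]; have [a Tx] : lspan e (T (iop_inv C x)) by rewrite -Te; exists (iop_inv C x).
by exists a; rewrite /= Tx linear_sum; apply: eq_bigr => i _; rewrite linearZ.
Qed.

Definition conj_op T : finrank H.
Proof.
apply: (@FinRank _ _ _ (C \o T \o iop_inv C)); last exact: conj_finite.
- by move=> a x y; rewrite /= !linearP.
- apply: bounded_comp (iop_inv_bounded C); exact: bounded_comp (iop_bounded C) (fr_bounded T).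
Defined.

Definition linked_pair T : cone (FH H) * cone (FH' H) := (gamma T, tau (conj_op T)).

(** Both projections read off the same decomposition: if [C^-1 x = C^-1 q + C^-1 r]
    with [q] in [N] and [r] orthogonal to [N], then [P_N x = q] and
    [Q_{C^-1(N)} (C^-1 x) = C^-1 q]. *)
Lemma PBP_transport M N (A : {linear fdelt (fdimg (iop_inv C) N) -> fdelt M}) :
  PBP (transport A) = conj_op (QAP A).
Proof.
apply: finrank_eq => x /=; congr (C (fdval (A _))); apply: val_inj => /=.
set p := iproj C N (iop_inv C x).
have [q Nq qp] := fdeltP p.
have [r Or rp] := projection_split (iprojP C N) (iop_inv C x).
rewrite -/p -qp in rp *; congr (iop_inv C _).
have xE : x = q + r.
  by apply: (can_inj (iop_invK C)); rewrite linearD rp subrKC.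
have [PK Pr Pk] := oprojP N.
have Pr0 : oproj N r = 0 by move: Or; rewrite -Pk.
rewrite xE linearD Pr0 addr0.
by move: Nq; rewrite -Pr => -[y _ <-]; rewrite PK.
Qed.

(** Whichever [A] the map [chi] has chosen, [QAP A] is an operator with cone [g]. *)
Lemma linked_form g t : linked C g t -> exists T, (g, t) = linked_pair T.
Proof.
case=> _ _ [M [N [h ->]]]; rewrite /chi; case: (cid2 _) => A /= _ gA.
by exists (QAP A); rewrite /linked_pair gA PBP_transport.
Qed.

Hypothesis C_unitary : unitary C.

Lemma unitary_inner x y : '[C x, C y] = '[x, y].
Proof. by rewrite C_unitary iopK. Qed.

Lemma norm_unitary x : `|C x| = `|x|.
Proof.
apply/eqP; rewrite -(@eqrXn2 _ 2) ?normr_ge0 //.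
by rewrite -!innerE unitary_inner.
Qed.

(** Take for [C^-1(N)] the range of [adjoint T], and for [A] the restriction of [T]
    to it. What [Q_{C^-1(N)}] discards lies in [C^-1(N^perp)], which
    is orthogonal to this range as [C] preserves inner products, so [T] kills it. *)
Lemma QAP_all T : exists M N (A : {linear fdelt (fdimg (iop_inv C) N) -> fdelt M}), QAP A = T.
Proof.
pose N := fdimg C (range_fd (adjoint T)).
pose a (y : fdelt (fdimg (iop_inv C) N)) : fdelt (range_fd T) := FdElt (range_fdP T (fdval y)).
have al : linear a by move=> k x y; apply: val_inj; rewrite /= linearP.
exists (range_fd T), N, (HB.pack a (GRing.isLinear.Build _ _ _ _ a al) : {linear _ -> _}).
apply: finrank_eq => x /=; apply/eqP; rewrite eq_sym -subr_eq0 -linearB; apply/eqP.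
have [w Nw <-] := projection_split (iprojP C N) x.
apply: inner_ext => z; rewrite linear0r; apply: inner_sym.
rewrite adjointP -unitary_inner iop_invK; apply: Nw.
by exists (adjoint T z) => //; exists z.
Qed.

Lemma linked_pairP T : linked C (gamma T) (tau (conj_op T)).
Proof.
split; [exact: gamma_normal|exact: tau_normal|].
have [M [N [A AT]]] := QAP_all T.
have h : Gamma C M N (gamma T) by exists A => //; rewrite AT.
exists M, N, h; rewrite /chi; case: (cid2 _) => B /= _ BT.
by rewrite PBP_transport (gamma_inj BT).
Qed.

Lemma linked_pairs_range : linked_pairs C = range linked_pair.
Proof.
apply/seteqP; split=> [[g t] /linked_form[T ->]|_ [T _ <-]]; first by exists T.
exact: linked_pairP.
Qed.

Lemma linked_pair_inj : injective linked_pair.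
Proof. by move=> T1 T2 /(congr1 fst)/gamma_inj. Qed.

(** A unitary operator permutes the unit ball and preserves norms. *)
Lemma norm_conj T : fr_norm (conj_op T) = fr_norm T.
Proof.
congr sup; apply/seteqP; split=> _ [x /= x1 <-].
  exists (iop_inv C x); first by rewrite /= -norm_unitary iop_invK.
  by rewrite -[LHS]/(re _) norm_unitary.
exists (C x); first by rewrite /= norm_unitary.
by rewrite /= iopK norm_unitary.
Qed.
End Linked.

(** * The normed algebra of finite rank operators *)

Section OperatorNorm.
Implicit Type c : R.

Lemma fr_norm_bound T x : nrm (T x) <= fr_norm T * nrm x.
Proof.
have [->|x0] := eqVneq x 0; first by rewrite linear0 nrm0 mulr0.
have nx0 : `|x| != 0 by rewrite normr_eq0.
rewrite -[in leLHS](scalerKV nx0 x) linearZ nrmZ normr_id mulrC.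
rewrite ler_wpM2r ?nrm_ge0 //; apply: ub_le_sup; last first.
  by exists (`|x|^-1 *: x) => //=; rewrite normrZ normfV normr_id mulVf.
have [c c0 cT] := bounded_ge0 (fr_bounded T).
exists (re c) => _ [y /= y1 <-]; apply: le_re.
by rewrite (le_trans (cT y)) // ler_piMr.
Qed.

Lemma fr_norm_le T c : 0 <= c -> (forall x, nrm (T x) <= c * nrm x) -> fr_norm T <= c.
Proof.
move=> c0 cT; apply: ge_sup; first by exists (re `|T 0|), 0 => //=; rewrite normr0.
move=> _ [y /= y1 <-]; apply: le_trans (cT y) _.
by rewrite ler_piMr // -[1](re1 R s); exact: le_re.
Qed.

Lemma fr_norm_ge0 T : 0 <= fr_norm T.
Proof.
(* If [H = 0], the estimate [fr_norm_bound] says nothing about [fr_norm T]. *)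
have [[x x0]|nx] := pselect (exists x : H, x != 0).
  have nx0 : 0 < nrm x by rewrite lt_neqAle nrm_ge0 andbT eq_sym; apply: contra_neq x0; exact: nrm_eq0.
  by rewrite -(pmulr_lge0 _ nx0) (le_trans (nrm_ge0 _) (fr_norm_bound T x)).
apply: ub_le_sup.
  exists 0 => _ [y _ <-]; have [->|y0] := eqVneq (T y) 0; last by case: nx; exists (T y).
  by rewrite normr0 re0.
by exists 0; rewrite /= ?linear0 normr0 ?re0.
Qed.

Lemma fr_norm0_eq T : fr_norm T = 0 -> T = fr0 H.
Proof.
move=> T0; apply: finrank_eq => x; apply: nrm_eq0; apply: le_anti.
by rewrite nrm_ge0 (le_trans (fr_norm_bound T x)) // T0 mul0r.
Qed.

Lemma fr_norm_fr0 : fr_norm (fr0 H) = 0.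
Proof.
apply: le_anti; rewrite fr_norm_ge0 andbT; apply: fr_norm_le => // x.
by rewrite nrm0 mul0r.
Qed.

Lemma re_norm_ge0 (k : K) : 0 <= re `|k|.
Proof. by rewrite -(re0 R s) le_re. Qed.

Lemma fr_norm_scale_le k T : fr_norm (fr_scale k T) <= re `|k| * fr_norm T.
Proof.
apply: fr_norm_le => [|x]; first by rewrite mulr_ge0 ?re_norm_ge0 ?fr_norm_ge0.
by rewrite nrmZ -mulrA ler_wpM2l ?re_norm_ge0 // fr_norm_bound.
Qed.

(** The missing inequality is [fr_norm_scale_le] for the scalar [k^-1] and the
    operator [k T]. *)
Lemma fr_normZ k T : fr_norm (fr_scale k T) = re `|k| * fr_norm T.
Proof.
apply: le_anti; rewrite fr_norm_scale_le /=.
have [->|k0] := eqVneq k 0; first by rewrite normr0 re0 mul0r fr_norm_ge0.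
have -> : fr_norm (fr_scale k T) = re `|k| * (re `|k^-1| * fr_norm (fr_scale k T)).
  by rewrite mulrA -ge0_reM // -normrM mulfV // normr1 re1 mul1r.
rewrite ler_wpM2l ?re_norm_ge0 //.
have {1}-> : T = fr_scale k^-1 (fr_scale k T).
  by apply: finrank_eq => x /=; rewrite scalerK.
exact: fr_norm_scale_le.
Qed.

Lemma finrank_normed_algebra : normed_algebra [set: finrank H] (finrank_ops H).
Proof.
split=> //=.
- by move=> x y z *; apply: finrank_eq => u /=; rewrite addrA.
- by move=> x y *; apply: finrank_eq => u /=; rewrite addrC.
- exists (fr0 H) => // T _; split.
  + by apply: finrank_eq => u /=; rewrite add0r.
  + exists (fr_scale (-1) T) => //.
    by apply: finrank_eq => u /=; rewrite scaleN1r addNr.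
  + by split=> [/fr_norm0_eq|->] //; exact: fr_norm_fr0.
- by move=> k l T *; apply: finrank_eq => u /=; rewrite scalerA.
- by move=> T *; apply: finrank_eq => u /=; rewrite scale1r.
- by move=> k x y *; apply: finrank_eq => u /=; rewrite scalerDr.
- by move=> k l T *; apply: finrank_eq => u /=; rewrite scalerDl.
- by move=> x y z *; apply: finrank_eq.
- by move=> x y z *; apply: finrank_eq => u /=; rewrite linearD.
- by move=> x y z *; apply: finrank_eq.
- by move=> k x y *; apply: finrank_eq => u /=; rewrite linearZ.
- by move=> k x y *; apply: finrank_eq.
- by move=> T *; exact: fr_norm_ge0.
- by move=> k T *; exact: fr_normZ.
- move=> x y *; apply: fr_norm_le => [|u]; first by rewrite addr_ge0 ?fr_norm_ge0.
  by rewrite (le_trans (nrmD _ _)) // mulrDl lerD ?fr_norm_bound.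
- move=> x y *; apply: fr_norm_le => [|u]; first by rewrite mulr_ge0 ?fr_norm_ge0.
  rewrite (le_trans (fr_norm_bound y (x u))) // mulrAC [leRHS]mulrC ler_wpM2l ?fr_norm_ge0 //.
  exact: fr_norm_bound.
Qed.

Lemma finrank_regular : regular_semigroup [set: finrank H] (@fr_mul R s H).
Proof.
split=> // [x y z _ _ _|T _]; first exact: finrank_eq.
by have [S [TST _]] := generalized_inverse T; exists S => //; exact: finrank_eq.
Qed.

End OperatorNorm.

(** * The isomorphism *)

Lemma linked_pair_iso (C : invertible_op H) : unitary C ->
  normed_algebra_iso [set: finrank H] (finrank_ops H) (linked_pairs C) (pair_ops H) (linked_pair C).
Proof.
move=> uC; split.
  rewrite linked_pairs_range //; split; first by move=> T _; exists T.
    by move=> T1 T2 _ _; exact: linked_pair_inj.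
  by [].
split=> /=.
- move=> x y _ _; rewrite /gadd /tadd !gamma_opK !tau_opK.
  by congr (_, tau _); apply: finrank_eq => u /=; rewrite linearD.
- move=> k x _; rewrite /gscale /tscale !gamma_opK !tau_opK.
  by congr (_, tau _); apply: finrank_eq => u /=; rewrite linearZ.
- move=> x y _ _; rewrite /gmul /tmul !gamma_opK !tau_opK.
  by congr (_, tau _); apply: finrank_eq => u /=; rewrite iopK.
- by move=> x _; rewrite /Defs.gnorm /tnorm gamma_opK tau_opK norm_conj // maxxx.
Qed.

End HilbertSpace.

(** * Transport of structure along an isomorphism *)

Section Transfer.
Variables (R : realType) (s : scalar_kind) (X Y : Type).
Variables (o : alg_ops R s X) (D : set Y) (o' : alg_ops R s Y) (f : X -> Y).
Hypothesis f_iso : normed_algebra_iso [set: X] o D o' f.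

Let f_mem x : D (f x). Proof. by case: f_iso => -[fD _ _] _; apply: fD. Qed.
Let f_surj y : D y -> exists x, y = f x.
Proof. by case: f_iso => -[_ _ fs] _ /fs[x _ <-]; exists x. Qed.
Let f_inj : injective f.
Proof. by case: f_iso => -[_ fi _] _ x y; apply: fi; rewrite in_setE. Qed.
Let fD x y : op_add o' (f x) (f y) = f (op_add o x y).
Proof. by case: f_iso => _ [fD _ _ _]; rewrite fD. Qed.
Let fZ k x : op_scale o' k (f x) = f (op_scale o k x).
Proof. by case: f_iso => _ [_ fZ _ _]; rewrite fZ. Qed.
Let fM x y : op_mul o' (f x) (f y) = f (op_mul o x y).
Proof. by case: f_iso => _ [_ _ fM _]; rewrite fM. Qed.
Let fN x : op_norm o' (f x) = op_norm o x.
Proof. by case: f_iso => _ [_ _ _ fN]; rewrite fN. Qed.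

Lemma iso_normed_algebra : normed_algebra [set: X] o -> normed_algebra D o'.
Proof.
case=> _ _ _ addA addC [z _ zP] sA s1 sDr sDl mA mDl mDr sAl sAr n0 nZ nD nM.
split.
- by move=> _ _ /f_surj[x ->] /f_surj[y ->]; rewrite fD.
- by move=> k _ /f_surj[x ->]; rewrite fZ.
- by move=> _ _ /f_surj[x ->] /f_surj[y ->]; rewrite fM.
- by move=> _ _ _ /f_surj[x ->] /f_surj[y ->] /f_surj[w ->]; rewrite !fD addA.
- by move=> _ _ /f_surj[x ->] /f_surj[y ->]; rewrite !fD addC.
- exists (f z) => // _ /f_surj[x ->]; have [zx [y _ yx] nx] := zP x I; split.
  + by rewrite fD zx.
  + by exists (f y); rewrite ?fD ?yx.
  + by rewrite fN nx; split=> [->|/f_inj].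
- by move=> k l _ /f_surj[x ->]; rewrite !fZ sA.
- by move=> _ /f_surj[x ->]; rewrite fZ s1.
- by move=> k _ _ /f_surj[x ->] /f_surj[y ->]; rewrite !(fD, fZ) sDr.
- by move=> k l _ /f_surj[x ->]; rewrite !fZ fD sDl.
- by move=> _ _ _ /f_surj[x ->] /f_surj[y ->] /f_surj[w ->]; rewrite !fM mA.
- by move=> _ _ _ /f_surj[x ->] /f_surj[y ->] /f_surj[w ->]; rewrite !(fD, fM) mDl.
- by move=> _ _ _ /f_surj[x ->] /f_surj[y ->] /f_surj[w ->]; rewrite !(fD, fM) mDr.
- by move=> k _ _ /f_surj[x ->] /f_surj[y ->]; rewrite !(fZ, fM) sAl.
- by move=> k _ _ /f_surj[x ->] /f_surj[y ->]; rewrite !(fZ, fM) sAr.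
- by move=> _ /f_surj[x ->]; rewrite fN n0.
- by move=> k _ /f_surj[x ->]; rewrite fZ !fN nZ.
- by move=> _ _ /f_surj[x ->] /f_surj[y ->]; rewrite fD !fN nD.
- by move=> _ _ /f_surj[x ->] /f_surj[y ->]; rewrite fM !fN nM.
Qed.

Lemma iso_regular_semigroup : regular_semigroup [set: X] (op_mul o) ->
  regular_semigroup D (op_mul o').
Proof.
case=> _ mA reg; split.
- by move=> _ _ /f_surj[x ->] /f_surj[y ->]; rewrite fM.
- by move=> _ _ _ /f_surj[x ->] /f_surj[y ->] /f_surj[w ->]; rewrite !fM mA.
- by move=> _ /f_surj[x ->]; have [y _ xyx] := reg x I; exists (f y); rewrite ?fM ?xyx.
Qed.

End Transfer.

Theorem theorem8 (R : realType) (s : scalar_kind) (H : hilbert R s)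
    (C : invertible_op H) (C_unitary : unitary C) :
  [/\ regular_semigroup (linked_pairs C) (op_mul (pair_ops H)),
      normed_algebra (linked_pairs C) (pair_ops H)
    & exists f : finrank H -> cone (FH H) * cone (FH' H),
        normed_algebra_iso [set: finrank H] (finrank_ops H)
          (linked_pairs C) (pair_ops H) f].
Proof.
have f_iso := linked_pair_iso C_unitary; split.
- exact: iso_regular_semigroup f_iso (finrank_regular H).
- exact: iso_normed_algebra f_iso (finrank_normed_algebra H).
- by exists (linked_pair C).
Qed.
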